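(* Let $D=(V,A)$ be a digraph with $uv\in A$, and let $D-uv=(V,A\setminus\{uv\})$. Then $\gamma^+_{maj}(D)-2\leq \gamma^+_{maj}(D-uv)\leq \gamma^+_{maj}(D)+2$. Moreover, both bounds are sharp (each is attained for some digraph $D$ and arc $uv$).
   Context: Digraphs are finite, without loops or multiple arcs (pairs of opposite arcs allowed). For $u\in V$, $N^+[u]=\{u\}\cup\{v: uv\in A\}$. For $f:V\to\{-1,1\}$ and $X\subseteq V$, $f(X)=\sum_{v\in X}f(v)$. A majority out-dominating function (MODF) of $D$ is a function $f:V\to\{-1,1\}$ with $|\{v\in V: f(N^+[v])\geq1\}|\geq |V|/2$; its weight is $w(f)=f(V)$. $\gamma^+_{maj}(D)$ is the minimum weight of a MODF of $D$. *)

(* Defs.v *)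
From mathcomp Require Import all_boot all_order all_algebra.
Set Implicit Arguments.
Unset Strict Implicit.
Unset Printing Implicit Defensive.
Import Order.TTheory GRing.Theory Num.Theory.
Local Open Scope ring_scope.

Record digraph := Digraph {
  vertex :> finType;
  is_arc : rel vertex;
  arc_irr : irreflexive is_arc }.

Definition del_arc_rel (D : digraph) (u v : D) : rel D :=
  fun x y => is_arc x y && ((x, y) != (u, v)).

Lemma del_arc_irr (D : digraph) (u v : D) : irreflexive (del_arc_rel u v).
Proof. by move=> x; rewrite /del_arc_rel arc_irr. Qed.

Definition del_arc (D : digraph) (u v : D) : digraph :=
  Digraph (del_arc_irr u v).

Definition out_nbhd (D : digraph) (u : D) : {set D} := u |: [set v | is_arc u v].

Definition fsum (D : digraph) (f : D -> int) (X : {set D}) : int :=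
  \sum_(v in X) f v.

Definition weight (D : digraph) (f : D -> int) : int := fsum f [set: D].

(* The bound |{v : f(N^+[v]) >= 1}| >= |V|/2 is doubled to stay in nat. *)
Definition modf (D : digraph) (f : D -> int) : bool :=
  [forall v, (f v == -1) || (f v == 1)] &&
  (#|D| <= 2 * #|[set v : D | (1 <= fsum f (out_nbhd v))%R]|)%N.

(* Functions V -> {-1, 1} are enumerated by {ffun D -> bool}. *)
Definition signf (D : digraph) (g : {ffun D -> bool}) : D -> int :=
  fun v => if g v then 1 else -1.

(* gamma^+_maj(D). The constant function 1, used as the default of arg min, is
   always a MODF; lemma gamma_majP checks that this is the minimum weight. *)
Definition gamma_maj (D : digraph) : int :=
  weight (signf
    [arg min_(g < [ffun=> true] : {ffun D -> bool} | modf (signf g))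
       weight (signf g)]%O).

Lemma eq_fsum (D : digraph) (f1 f2 : D -> int) (X : {set D}) :
  f1 =1 f2 -> fsum f1 X = fsum f2 X.
Proof. by move=> e; apply: eq_bigr => v _; apply: e. Qed.

Lemma eq_modf (D : digraph) (f1 f2 : D -> int) :
  f1 =1 f2 -> modf f1 = modf f2.
Proof.
move=> e; rewrite /modf; congr (_ && (_ <= 2 * _)%N).
  by apply: eq_forallb => v; rewrite e.
by apply: eq_card => v; rewrite !inE (eq_fsum _ e).
Qed.

Lemma modf1 (D : digraph) : modf (signf ([ffun=> true] : {ffun D -> bool})).
Proof.
apply/andP; split; first by apply/forallP => v; rewrite /signf ffunE eqxx orbT.
rewrite (_ : [set v | _] = [set: D]) ?cardsT ?mul2n -?addnn ?leq_addl //.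
apply/setP => v; rewrite !inE /fsum (bigD1 v) /=; last by rewrite setU11.
rewrite {1}/signf ffunE lerDl; apply: sumr_ge0 => w _.
by rewrite /signf ffunE.
Qed.

Lemma gamma_majP (D : digraph) :
  (exists2 f : D -> int, modf f & weight f = gamma_maj D) /\
  (forall f : D -> int, modf f -> gamma_maj D <= weight f).
Proof.
rewrite /gamma_maj; case: arg_minP => [|g mg ming]; first exact: modf1.
split=> [|f mf]; first by exists (signf g).
have e : f =1 signf [ffun v => f v == 1].
  move=> v; rewrite /signf ffunE; case/andP: mf => /forallP/(_ v) + _.
  by case: (f v =P 1) => // _; rewrite orbF => /eqP.
by rewrite /weight (eq_fsum _ e); apply: ming; rewrite -(eq_modf e).
Qed.

(* Main.v *)
Require Import Defs.
From mathcomp Require Import all_boot all_order all_algebra.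
From mathcomp Require Import zify.
Import Order.TTheory GRing.Theory Num.Theory.
Set Implicit Arguments.
Unset Strict Implicit.
Unset Printing Implicit Defensive.
Local Open Scope ring_scope.

(** If two digraphs differ only by one arc leaving [u], a MODF [f] of the first
    can fail in the second only because [f(N+[u])] drops from 1 to 0; then some
    vertex of [N+[u]] has value -1, and raising it to 1 repairs [f] at cost 2.
    Sharpness is witnessed on two and three vertices: deleting an arc of the
    complete digraph on two vertices lowers 2 to 0, and deleting the chord of a
    directed triangle with one chord raises 1 to 3. *)

Lemma gamma_maj_unique (D : digraph) (f : D -> int) :
  modf f -> (forall g : D -> int, modf g -> weight f <= weight g) ->
  gamma_maj D = weight f.
Proof.
move=> mf minf; have [[g mg wg] ming] := gamma_majP D.
by apply/le_anti; rewrite ming //= -wg minf.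
Qed.

Definition raise (T : eqType) (f : T -> int) (w : T) : T -> int :=
  fun x => if x == w then 1 else f x.

Lemma sum_raise (T : finType) (f : T -> int) (w : T) (X : {set T}) :
  f w = -1 ->
  \sum_(x in X) raise f w x = \sum_(x in X) f x + (if w \in X then 2 else 0).
Proof.
move=> fw; case: ifPn => wX; last first.
  rewrite addr0; apply: eq_bigr => x xX; rewrite /raise ifN //.
  by apply: contraNneq wX => <-.
rewrite (bigD1 w wX) [in RHS](bigD1 w wX) /= {1}/raise eqxx fw.
rewrite (eq_bigr f); last by move=> x /andP[_ /negPf xw]; rewrite /raise xw.
by lia.
Qed.

(** Both digraphs live on one vertex type and the bound is one-sided, so that swapping their roles
    covers deleting an arc as well as restoring it. *)
Lemma gamma_maj_perturb (T : finType) (e1 e2 : rel T)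
    (i1 : irreflexive e1) (i2 : irreflexive e2) (u : T) :
  let D1 := Digraph i1 in let D2 := Digraph i2 in
  (forall x, x != u -> out_nbhd (D := D1) x = out_nbhd (D := D2) x) ->
  (forall f : T -> int, @modf D1 f ->
     fsum (D := D1) f (out_nbhd (D := D1) u) - 1 <= fsum (D := D2) f (out_nbhd (D := D2) u)) ->
  gamma_maj D2 <= gamma_maj D1 + 2.
Proof.
move=> D1 D2 eqN closeN; have [[f mf <-] _] := gamma_majP D1.
have [_ min2] := gamma_majP D2.
have /andP[/forallP f_pm1 f_maj] := mf.
pose ok (D : digraph) (h : D -> int) :=
  [set x : D | 1 <= fsum h (out_nbhd x)].
(* If no vertex is lost, [f] itself is a MODF of [D2]; otherwise the lost vertex must be [u], the
   only one whose out-neighbourhood may change. *)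
have [sub|] := boolP (ok D1 f \subset ok D2 f).
  apply: le_trans (min2 f _) _; last by rewrite lerDl.
  apply/andP; split; first exact/forallP.
  by apply: leq_trans f_maj _; rewrite leq_mul2l subset_leq_card.
case/subsetPn=> y; rewrite !inE -ltNge => y1 y2.
have yu : y = u.
  by apply: contraTeq y2 => yu; rewrite -leNgt -[X in fsum _ X](eqN y yu).
rewrite {y}yu in y1 y2.
(* Were [f] equal to 1 on all of [N+[u]] in [D2], the term of [u] alone would make the sum at least
   1, against [y2]. *)
have [w wN fw] : exists2 w, w \in out_nbhd (D := D2) u & f w = -1.
  have [/existsP[w /andP[wN /eqP fw]]|/existsPn noN] :=
    boolP [exists w, (w \in out_nbhd (D := D2) u) && (f w == -1)]; first by exists w.
  have f1 x : x \in out_nbhd (D := D2) u -> f x = 1.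
    move=> xN; have := noN x; rewrite xN /= => /negPf fx.
    by have := f_pm1 x; rewrite fx => /eqP.
  move: y2; rewrite ltNge /fsum (bigD1 u) /= ?setU11 //.
  rewrite (f1 u) ?setU11 // lerDl sumr_ge0 //.
  by move=> x /andP[/f1 -> _].
have sumE X := @sum_raise T f w X fw.
apply: le_trans (min2 (raise (T := T) f w) _) _; last first.
  by rewrite /weight /fsum sumE in_setT.
apply/andP; split.
  by apply/forallP => x; rewrite /raise; case: ifP => _; rewrite ?eqxx ?orbT ?f_pm1.
apply: leq_trans f_maj _; rewrite leq_mul2l /=; apply/subset_leq_card/subsetP.
(* At [u] the gain of 2 from [w] outweighs the loss of at most 1; elsewhere raising a value cannot
   decrease a sum. *)
move=> x; rewrite !inE [X in _ -> _ <= X]sumE; case: (eqVneq x u) => [-> _|xu].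
  rewrite wN; apply: le_trans (_ : fsum (D := D1) f (out_nbhd (D := D1) u) - 1 + 2 <= _).
    by lia.
  by rewrite lerD2r; apply: closeN.
rewrite [X in fsum _ X](eqN x xu) /fsum => /le_trans -> //.
by rewrite lerDl; case: ifP.
Qed.

Lemma modf_pm1 (D : digraph) (f : D -> int) (x : D) :
  modf f -> f x = -1 \/ f x = 1.
Proof. by case/andP=> /forallP/(_ x)/orP[]/eqP; [left | right]. Qed.

Lemma out_nbhd_del_arc (D : digraph) (u v x : D) : is_arc u v ->
  out_nbhd x = if x == u then v |: out_nbhd (D := del_arc u v) u
                 else out_nbhd (D := del_arc u v) x.
Proof.
move=> uv; apply/setP => y; case: eqVneq => [->|xu]; rewrite !inE /= /del_arc_rel.
  by rewrite xpair_eqE eqxx; case: (eqVneq y v) => [->|]; rewrite ?uv ?orbT ?andbT.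
by rewrite xpair_eqE (negPf xu) andbT.
Qed.

Lemma notin_out_nbhd_del_arc (D : digraph) (u v : D) : is_arc u v ->
  v \notin out_nbhd (D := del_arc u v) u.
Proof.
move=> uv; rewrite !inE /= /del_arc_rel eqxx andbF orbF.
by apply: contraTneq uv => ->; rewrite arc_irr.
Qed.

Lemma fsum_out_nbhd_del_arc (D : digraph) (u v : D) (f : D -> int) :
  is_arc u v ->
  fsum f (out_nbhd u) =
  f v + fsum (D := del_arc u v) f (out_nbhd (D := del_arc u v) u).
Proof.
move=> uv; rewrite (out_nbhd_del_arc _ uv) eqxx /fsum.
by rewrite big_setU1 ?notin_out_nbhd_del_arc.
Qed.

Lemma gamma_maj_del_arc (D : digraph) (u v : D) : is_arc u v ->
  gamma_maj D - 2 <= gamma_maj (del_arc u v) /\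
  gamma_maj (del_arc u v) <= gamma_maj D + 2.
Proof.
case: D u v => T e i u v uv.
have outE := @out_nbhd_del_arc (Digraph i) u v ^~ uv.
have sumE f := @fsum_out_nbhd_del_arc (Digraph i) u v f uv.
(* The lower bound passes from [del_arc u v] to the full digraph, the upper bound the other way. The
   sums at [u] differ by [f v], which is 1 or -1. *)
split; rewrite ?lerBlDr; apply: (@gamma_maj_perturb _ _ _ _ _ u).
- by move=> x xu; rewrite outE (negPf xu).
- by move=> f mf; rewrite sumE addrC lerD2r; case: (@modf_pm1 (del_arc u v) f v mf) => ->.
- by move=> x xu; rewrite outE (negPf xu).
- by move=> f mf; rewrite sumE lerBlDr addrC lerD2l; case: (@modf_pm1 (Digraph i) f v mf) => ->.
Qed.

(** Turns set cardinals into sums over ordinals, which unfold and evaluate on a concrete digraph. *)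
Lemma modf_ordE (n : nat) (e : rel 'I_n) (i : irreflexive e) (f : 'I_n -> int) :
  @modf (Digraph i) f =
  [forall v, (f v == -1) || (f v == 1)] &&
  (n <= 2 * \sum_(v < n)
     (1 <= \sum_(w < n) if (w == v) || e v w then f w else 0 : int)%R)%N.
Proof.
rewrite /modf card_ord -sum1_card big_mkcond /=.
congr (_ && (_ <= 2 * _)%N); apply: eq_bigr => v _; rewrite inE /fsum big_mkcond /=.
under eq_bigr => w _ do rewrite !inE.
by case: (1 <= _).
Qed.

Lemma weight_ordE (n : nat) (e : rel 'I_n) (i : irreflexive e) (f : 'I_n -> int) :
  @weight (Digraph i) f = \sum_(v < n) f v.
Proof. by apply: eq_bigl => v; rewrite inE. Qed.

Definition K2_rel : rel 'I_2 := fun x y => x != y.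

Lemma K2_irr : irreflexive K2_rel.
Proof. by move=> x; rewrite /K2_rel eqxx. Qed.

Definition K2 := Digraph K2_irr.

(* The arcs are 0 -> 1 -> 2 -> 0 and the chord 0 -> 2. *)
Definition C3_chord_rel : rel 'I_3 :=
  fun x y => (val x, val y) \in [:: (0, 1); (1, 2); (2, 0); (0, 2)]%N.

Lemma C3_chord_irr : irreflexive C3_chord_rel.
Proof. by case=> [[|[|[]]]]. Qed.

Definition C3_chord := Digraph C3_chord_irr.

Lemma gamma_maj_ord (n : nat) (e : rel 'I_n) (i : irreflexive e)
    (f : 'I_n -> int) (k : int) :
  @modf (Digraph i) f -> \sum_(v < n) f v = k ->
  (forall g, @modf (Digraph i) g -> k <= \sum_(v < n) g v) ->
  gamma_maj (Digraph i) = k.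
Proof.
move=> mf <- minf; rewrite -(weight_ordE i).
by apply: gamma_maj_unique mf _ => g mg; rewrite !weight_ordE; apply: minf.
Qed.

(** Checks the witness [f] and its weight, then proves minimality by running through all sign
    patterns of a competitor [g]. *)
Ltac gamma_ord_compute f :=
  apply: (gamma_maj_ord (f := f));
  [ rewrite modf_ordE !big_ord_recl !big_ord0; apply/andP; split => //;
    apply/forallP; by case=> [[|[|[]]]]
  | by rewrite !big_ord_recl big_ord0
  | let g := fresh "g" in let mg := fresh "mg" in let pm := fresh "pm" in
    move=> g mg;
    have pm x := modf_pm1 x mg; move: mg;
    rewrite modf_ordE !big_ord_recl !big_ord0 => /andP[_];
    repeat match goal with |- context [g ?x] => case: (pm x) => -> end;
    by [] ].

(** Both closed out-neighbourhoods are the whole vertex set, so a MODF has positive, hence by parity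
    full, weight. *)
Lemma gamma_maj_K2 : gamma_maj K2 = 2.
Proof. gamma_ord_compute (fun _ : 'I_2 => 1 : int). Qed.

Lemma gamma_maj_K2_del : gamma_maj (@del_arc K2 ord0 ord_max) = 0.
Proof. gamma_ord_compute (fun x : 'I_2 => if x == ord0 then 1 else -1 : int). Qed.

Lemma gamma_maj_C3_chord : gamma_maj C3_chord = 1.
Proof.
gamma_ord_compute (fun x : 'I_3 => if val x == 1%N then -1 else 1 : int).
Qed.

(** In the directed triangle each vertex lies in two of the three closed out-neighbourhoods, all of
    size 2, so a single -1 spoils two vertices. *)
Lemma gamma_maj_C3_chord_del : gamma_maj (@del_arc C3_chord ord0 ord_max) = 3.
Proof. gamma_ord_compute (fun _ : 'I_3 => 1 : int). Qed.

Theorem theorem3p9 :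
  (forall (D : digraph) (u v : D), is_arc u v ->
     gamma_maj D - 2 <= gamma_maj (del_arc u v) /\
     gamma_maj (del_arc u v) <= gamma_maj D + 2) /\
  (exists (D : digraph) (u v : D),
     is_arc u v /\ gamma_maj (del_arc u v) = gamma_maj D - 2) /\
  (exists (D : digraph) (u v : D),
     is_arc u v /\ gamma_maj (del_arc u v) = gamma_maj D + 2).
Proof.
split; first exact: gamma_maj_del_arc.
split.
  exists K2, ord0, ord_max; split => //.
  by rewrite gamma_maj_K2_del gamma_maj_K2.
exists C3_chord, ord0, ord_max; split => //.
by rewrite gamma_maj_C3_chord_del gamma_maj_C3_chord.
Qed.
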